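(* Let $k\ge 2$ be an integer and $\varepsilon>0$. There exist constants $c=c(k,\varepsilon)>0$ and $n_0=n_0(k,\varepsilon)$ such that every graph $G$ on $n\ge n_0$ vertices with \[ q(G)\ge \left(1-\frac{1}{k}+\varepsilon\right)2n \] contains a copy of $K_{k+1}[t]$ for some $t\ge c\log n$.
   Context: All graphs are finite and simple. For a graph $G$, $q(G)$ denotes the largest eigenvalue of the signless Laplacian $Q(G)=D(G)+A(G)$, where $D(G)$ is the diagonal degree matrix and $A(G)$ the adjacency matrix. For a graph $F$ and integer $t\ge1$, the $t$-blowup $F[t]$ is obtained by replacing every vertex of $F$ by an independent set of size $t$ and every edge of $F$ by a complete bipartite graph $K_{t,t}$ between the corresponding sets. Thus $K_{k+1}[t]$ is the complete $(k+1)$-partite graph with all parts of size $t$. *)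

(* Defs.v *)
From HB Require Import structures.
From mathcomp Require Import all_boot all_order all_algebra.
From mathcomp Require Import polyrcf.
From mathcomp Require Import reals exp.
Set Implicit Arguments. Unset Strict Implicit. Unset Printing Implicit Defensive.
Import Order.TTheory GRing.Theory Num.Theory.
Local Open Scope ring_scope.

Definition simple_graph (T : finType) (e : rel T) : Prop :=
  irreflexive e /\ symmetric e.

Definition deg (T : finType) (e : rel T) (x : T) : nat := #|[set y | e x y]|.

Definition signless_laplacian (R : nzRingType) (n : nat) (e : rel 'I_n) : 'M[R]_n :=
  \matrix_(i, j) ((if i == j then (deg e i)%:R else 0) + (if e i j then 1 else 0)).

(* q(G): the largest eigenvalue of Q(G), i.e. the largest real root of its
   characteristic polynomial (Q(G) is real symmetric, so all eigenvalues are real;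
   they are also >= 0, so taking max with 0 is harmless; q = 0 for the empty graph). *)
Definition q_signless (R : rcfType) (n : nat) (e : rel 'I_n) : R :=
  \big[Num.max/0]_(x <- rootsR (char_poly (signless_laplacian R e))) x.

Definition complete_graph (m : nat) : rel 'I_m := fun i j => i != j.

Definition blowup (T : finType) (F : rel T) (t : nat) : rel (T * 'I_t)%type :=
  fun u v => F u.1 v.1.

Definition contains_copy (S T : finType) (H : rel S) (G : rel T) : Prop :=
  exists f : S -> T, injective f /\ forall x y, H x y -> G (f x) (f y).

(* Main.v *)
(* The spectral condition is turned into a minimum degree condition on a large
   induced subgraph, where the greedy Bollobas-Erdos argument applies.
   Let x be a unit Perron vector of Q(G[S]), s = |S|, q = q(G[S]), and m its least
   entry. If some vertex of S has degree at most (1 - 1/k + eps/2) s in G[S], its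
   eigenvalue equation forces m^2 <= 1/((1 + 2 eps) s), and deleting a vertex with
   entry m then raises the density q/s by at least gam/(s - 1), for a constant
   gam > 0. Since q/s never exceeds 2 and the gains sum to gam (ln n - ln s), the
   deletions stop at some S with s >= exp(-1/gam) n and minimum degree above
   (1 - 1/k + eps/2) s.
   In such a G[S], given a copy K of K_r[T] with r <= k, a positive proportion of
   the vertices have a positive proportion of neighbours in each part of K; if T is
   a small multiple of log s there are few traces on K, so enough of these vertices
   share the same one and form a new part. *)

Require Import Defs.
From HB Require Import structures.
From mathcomp Require Import all_boot all_order all_algebra.
From mathcomp Require Import polyrcf zify ring lra.
From mathcomp Require Import classical_sets reals topology normedtype sequences derive exp.
Set Implicit Arguments. Unset Strict Implicit. Unset Printing Implicit Defensive.
Import Order.TTheory GRing.Theory Num.Theory.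
Import numFieldNormedType.Exports.

Local Open Scope nat_scope.

(** * Growing a blowup one part at a time *)

Lemma inj_ord_in (T : finType) (X : {set T}) (t : nat) :
  t <= #|X| -> exists g : 'I_t -> T, injective g /\ forall j, g j \in X.
Proof.
move=> tX; exists (fun j => enum_val (widen_ord tX j)); split=> [i j /enum_val_inj|j].
  by move/(congr1 val) => /= /val_inj.
exact: enum_valP.
Qed.

Lemma pigeonhole_fiber (T C : finType) (G : {set T}) (N : T -> C) (t : nat) :
  #|C| * t < #|G| -> exists c, t < #|[set v in G | N v == c]|.
Proof.
move=> ltG; apply/existsP; apply: contraLR ltG => /existsPn fib.
rewrite -leqNgt -sum1_card (partition_big N xpredT) //= -sum_nat_const.
apply: leq_sum => c _; rewrite sum1dep_card.
by have := fib c; rewrite -leqNgt.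
Qed.

Lemma card_set_sum (T : finType) (P : pred T) : #|[set x | P x]| = \sum_x P x.
Proof. by rewrite -sum1dep_card big_mkcond; apply: eq_bigr => x _; case: (P x). Qed.

Lemma card_set_in_sum (T : finType) (A : {set T}) (P : pred T) :
  #|[set x in A | P x]| = \sum_(x in A) P x.
Proof.
by rewrite -sum1dep_card big_mkcondr; apply: eq_bigr => x _; case: (P x).
Qed.

(* S contains a copy of the complete r-partite graph with parts of size t,
   not necessarily induced. *)
Definition blowup_in (T : finType) (e : rel T) (S : {set T}) (r t : nat) : Prop :=
  exists f : 'I_r * 'I_t -> T,
    [/\ injective f, forall p, f p \in S
      & forall p q, p.1 != q.1 -> e (f p) (f q)].

(** Part sizes come from floor divisions and may be 0; this settles those cases. *)
Lemma blowup_in0 (T : finType) (e : rel T) (S : {set T}) (r : nat) :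
  blowup_in e S r 0.
Proof.
have no (p : 'I_r * 'I_0) : False by case: p => _ [].
by exists (fun p => False_rect T (no p)); split=> p; case: (no p).
Qed.

Section BlowupStep.
Variables (T : finType) (e : rel T) (S : {set T}) (k s r t0 : nat).
Variable f : 'I_r * 'I_t0 -> T.
Hypotheses (e_irr : irreflexive e) (e_sym : symmetric e).
Hypotheses (f_inj : injective f) (fS : forall p, f p \in S).
Hypothesis fe : forall p q, p.1 != q.1 -> e (f p) (f q).
Hypotheses (r_gt0 : 0 < r) (rk : r <= k) (t0_gt0 : 0 < t0).
(* Minimum degree at least (1 - 1/k + 2/s) |S|, with denominators cleared. *)
Hypothesis degS : forall v, v \in S ->
  (k * s + 2 * k) * #|S| <= #|[set y in S | e v y]| * (k * s) + s * #|S|.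

Let t := t0 %/ s.
Let row v i := [set j | e v (f (i, j))].
Let good := [set v in S | [forall i, t <= #|row v i|]].

Let adj_le v : \sum_p e v (f p) <= r * t0.
Proof.
apply: (@leq_trans (\sum_(p : 'I_r * 'I_t0) 1)); first by apply: leq_sum => p _; case: e.
by rewrite sum_nat_const card_prod !card_ord muln1.
Qed.

Let adj_bad v : v \in S -> v \notin good -> \sum_p e v (f p) <= r.-1 * t0 + t.
Proof.
move=> vS; rewrite inE vS /= negb_forall => /existsP[i0]; rewrite -ltnNge => lt_i0.
rewrite [X in X <= _](_ : _ = \sum_i #|row v i|); last first.
  under [RHS]eq_bigr do rewrite card_set_sum.
  by rewrite pair_bigA; apply: eq_bigr => -[].
rewrite (bigD1 i0) //= addnC leq_add ?(ltnW lt_i0) //.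
apply: (@leq_trans (\sum_(i < r | i != i0) t0)).
  by apply: leq_sum => i _; rewrite -[leqRHS]card_ord max_card.
rewrite sum_nat_const leq_mul2r; apply/orP; right.
by rewrite (cardC1 i0) card_ord.
Qed.

(* Double counting of the pairs (v, p) with v adjacent to f p: a vertex that is not
   good sees at most (r - 1) t0 + t vertices of the copy. *)
Let good_large : #|S| <= s * #|good|.
Proof.
have goodS : good \subset S by apply/fintype.subsetP => v; rewrite inE => /andP[].
have eqS : #|S| = #|good| + #|S :\: good|.
  by rewrite -(cardsID good S) (finset.setIidPr goodS).
have st : s * t <= t0 by rewrite mulnC leq_trunc_div.
have lo : (r * t0) * ((k * s + 2 * k) * #|S|) <=
    (\sum_(v in S) \sum_p e v (f p)) * (k * s) + (r * t0) * (s * #|S|).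
  rewrite exchange_big /= big_distrl /=.
  have -> : r * t0 = #|{: 'I_r * 'I_t0}| by rewrite card_prod !card_ord.
  rewrite -!sum_nat_const -big_split; apply: leq_sum => p _ /=.
  have := degS (fS p); rewrite card_set_in_sum.
  by under eq_bigr do rewrite e_sym.
have hi : \sum_(v in S) \sum_p e v (f p) <=
    #|good| * (r * t0) + #|S :\: good| * (r.-1 * t0 + t).
  rewrite (big_setID good) (finset.setIidPr goodS) /= leq_add // -sum_nat_const.
    exact: leq_sum.
  by apply: leq_sum => v /finset.setDP[vS vg]; exact: adj_bad.
move: lo hi; rewrite {}eqS.
move: #|good| #|_ :\: _| (\sum_(v in S) _) => g h A lo hi.
have {lo hi} : r * t0 * ((k * s + 2 * k) * (g + h)) <=
   (g * (r * t0) + h * (r.-1 * t0 + t)) * (k * s) + r * t0 * (s * (g + h)).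
  by rewrite (leq_trans lo) // leq_add2r leq_mul2r hi orbT.
case: r r_gt0 rk => // r' _ rk' /= bnd.
(* With [g] good and [h] other vertices and r = r' + 1, the two counts and s t <= t0 give k s h + 2
   k r (g + h) <= k h + r s (g + h), up to the factor [t0]. As r <= k, the term r s h is absorbed by
   k s h, so the truncated difference is 0. *)
have key : t0 * (2 * k * r'.+1 * g + k * (2 * r' + 1) * h) <= t0 * (r'.+1 * g * s) + t0 * (r'.+1 * s * h - k * s * h).
  have /(leq_mul (leqnn (h * k))) : s * t <= t0 by [].
  nia.
have : k * (r'.+1 * (g + h)) <= k * (r'.+1 * (s * g)); last first.
  rewrite !leq_pmul2l //; lia.
have : r'.+1 * s * h <= k * s * h by nia.
rewrite -subn_eq0 => /eqP h0; rewrite h0 muln0 addn0 leq_pmul2l // in key.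
nia.
Qed.

(** Sort the good vertices by their trace on the copy, a subset of its r t0 positions. Some trace
    [A] is shared by [t] of them; these form the new part, and [t] positions of [A] are kept in each
    old part. *)
Lemma blowup_in_step : 2 ^ (r.+1 * t0) <= #|S| -> blowup_in e S r.+1 t.
Proof.
move=> S_large.
have [-> | t_gt0] := posnP t; first exact: blowup_in0.
pose N v := [set p | e v (f p)].
have [A Afib] : exists A, t.-1 < #|[set v in good | N v == A]|.
  apply: pigeonhole_fiber; rewrite ltnNge; apply/negP => le_good.
  have cN : #|{set 'I_r * 'I_t0}| = 2 ^ (r * t0).
    by rewrite -cardsT -finset.powersetT card_powerset cardsT card_prod !card_ord.
  have st : s * t <= t0 by rewrite mulnC leq_trunc_div.
  have : s * #|good| <= t0 * 2 ^ (r * t0).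
    rewrite (leq_trans (leq_mul (leqnn s) le_good)) // cN.
    rewrite mulnCA mulnC leq_mul2r (leq_trans _ st) ?orbT // leq_mul2l leq_pred orbT //.
  (* Cancelling 2 ^ (r t0) would leave 2 ^ t0 <= t0. *)
  have : 2 ^ (r.+1 * t0) <= s * #|good| by exact: leq_trans good_large.
  rewrite mulSn expnD => le1 /(leq_trans le1); rewrite leq_pmul2r ?expn_gt0 //.
  by rewrite leqNgt ltn_expl.
rewrite prednK // in Afib.
have [w [w_inj wW]] := inj_ord_in Afib.
have wN j p : p \in A -> e (w j) (f p).
  by move: (wW j); rewrite !inE => /andP[_ /eqP <-]; rewrite inE.
have wS j : w j \in S by move: (wW j); rewrite !inE => /andP[/andP[]].
(* [A] is the trace of a good vertex, so it has at least [t] positions in every old part. *)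
have rowA i : exists g : 'I_t -> 'I_t0, injective g /\ forall j, (i, g j) \in A.
  have j0 : 'I_t by exact: Ordinal t_gt0.
  move: (wW j0); rewrite !inE => /andP[/andP[_ /forallP/(_ i)]] /inj_ord_in[g [gi gA]].
  by move=> /eqP NA; exists g; split=> // j; rewrite -NA; move: (gA j); rewrite !inE.
have [g gP] := fin_all_exists rowA.
(* The new part gets the last index. A new vertex equal to a kept old one would be its own
   neighbour, hence injectivity. *)
pose f' (p : 'I_r.+1 * 'I_t) :=
  if unlift ord_max p.1 is Some i then f (i, g i p.2) else w p.2.
have fA i j : (i, g i j) \in A by case: (gP i).
exists f'; split.
- move=> [i j] [i' j']; rewrite /f' /=.
  case: unliftP => [a|] ->; case: unliftP => [b|] -> .
  + move/f_inj => [<-]; rewrite -/(g a j) => /(proj1 (gP a)) -> //.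
  + by move=> E; have := wN j' _ (fA a j); rewrite -E e_irr.
  + by move=> E; have := wN j _ (fA b j'); rewrite -E e_irr.
  + by move/w_inj ->.
- by move=> [i j]; rewrite /f' /=; case: unliftP.
- move=> [i j] [i' j']; rewrite /f' /=.
  case: unliftP => [a|] ->; case: unliftP => [b|] -> .
  + by rewrite (inj_eq lift_inj) => ab; apply: fe.
  + by move=> _; rewrite e_sym wN.
  + by move=> _; rewrite wN.
  + by rewrite eqxx.
Qed.

End BlowupStep.

(** Induction on the number of parts, each step dividing the part size by [s]. The factor 2 k in the
    divisor pays for the exponent in the size condition, since r + 2 <= k + 1 <= 2 k. *)
Lemma blowup_in_log (T : finType) (e : rel T) (S : {set T}) (k s r : nat) :
  irreflexive e -> symmetric e -> 0 < s -> r < k.+1 ->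
  (forall v, v \in S ->
    (k * s + 2 * k) * #|S| <= #|[set y in S | e v y]| * (k * s) + s * #|S|) ->
  blowup_in e S r.+1 (trunc_log 2 #|S| %/ (2 * k * s ^ r)).
Proof.
move=> e_irr e_sym s_gt0 + degS; set L := trunc_log 2 #|S|.
elim: r => [|r IHr] rk.
  have [S0|S_gt0] := posnP #|S|; first by rewrite /L S0 trunc_log0 div0n; exact: blowup_in0.
  have : L %/ (2 * k * s ^ 0) <= #|S|.
    by rewrite (leq_trans (leq_div _ _)) // (leq_trans (ltnW (ltn_expl L (ltnSn 1)))) ?trunc_logP.
  move=> /inj_ord_in[g [gi gS]]; exists (fun p => g p.2); split=> //.
    by case=> i j [i' j'] /= /gi ->; rewrite !ord1.
  by move=> [i j] [i' j'] /=; rewrite !ord1.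
have [f [fi fS fe]] := IHr (ltnW rk).
rewrite expnSr mulnA divnMA; set t0 := L %/ _ in f fi fS fe *.
have [-> | t0_gt0] := posnP t0; first by rewrite div0n; exact: blowup_in0.
have S_gt0 : 0 < #|S|.
  by rewrite lt0n; apply: contraTneq t0_gt0 => S0; rewrite /t0 /L S0 trunc_log0 div0n.
apply: (blowup_in_step e_irr e_sym fi fS fe _ _ t0_gt0 degS) => //.
apply: leq_trans (trunc_logP (ltnSn 1) S_gt0); rewrite leq_exp2l // -/L.
have k_gt0 : 0 < k by lia.
have := leq_trunc_div L (2 * k * s ^ r); rewrite -/t0; apply: leq_trans.
rewrite mulnC leq_mul2l.
have : 0 < s ^ r by rewrite expn_gt0 s_gt0.
nia.
Qed.

(** * Perron vectors of the signless Laplacian *)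

Local Open Scope ring_scope.

Lemma mulmx_tr_sqr (R : comNzRingType) n (x : 'rV[R]_n) :
  (x *m x^T) 0 0 = \sum_i x 0 i ^+ 2.
Proof. by rewrite !mxE; apply: eq_bigr => i _; rewrite !mxE expr2. Qed.

Lemma rV_sqr_eq0 (R : realDomainType) n (x : 'rV[R]_n) :
  \sum_i x 0 i ^+ 2 <= 0 -> x = 0.
Proof.
move=> le0; apply/rowP => i; rewrite mxE; apply/eqP; rewrite -sqrf_eq0.
apply/eqP/(@psumr_eq0P _ _ xpredT (fun i => x 0 i ^+ 2)) => // [j _|].
  exact: sqr_ge0.
by apply/eqP; rewrite eq_le le0 sumr_ge0 // => j _; exact: sqr_ge0.
Qed.

(* z = x (mu - A) vanishes because the nonnegative form mu - A, evaluated at x - t z,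
   has linear term - 2 t |z|^2 in t. *)
Lemma rayleigh_max_eigen (R : realFieldType) n (A : 'M[R]_n) (x : 'rV_n) (mu : R) :
  A^T = A ->
  (forall y : 'rV_n, (y *m A *m y^T) 0 0 <= mu * (y *m y^T) 0 0) ->
  (x *m A *m x^T) 0 0 = mu * (x *m x^T) 0 0 ->
  x *m A = mu *: x.
Proof.
move=> Asym Ale Ax; pose B := mu%:M - A.
have Bsym : B^T = B by rewrite /B linearB /= tr_scalar_mx Asym.
have BE (y : 'rV[R]_n) : (y *m B *m y^T) 0 0 = mu * (y *m y^T) 0 0 - (y *m A *m y^T) 0 0.
  by rewrite /B mulmxBr mulmxBl mul_mx_scalar -scalemxAl !mxE.
have B_ge0 (y : 'rV[R]_n) : 0 <= (y *m B *m y^T) 0 0 by rewrite BE subr_ge0.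
have Bx0 : (x *m B *m x^T) 0 0 = 0 by rewrite BE Ax subrr.
suff : x *m B = 0.
  by rewrite /B mulmxBr mul_mx_scalar => /eqP; rewrite subr_eq0 => /eqP.
set z := x *m B; apply: rV_sqr_eq0; rewrite -mulmx_tr_sqr.
set nz : R := (z *m z^T) 0 0; set c : R := (z *m B *m z^T) 0 0.
have expand (t : R) : ((x - t *: z) *m B *m (x - t *: z)^T) 0 0 = - 2 * t * nz + t ^+ 2 * c.
  have zx : (z *m B *m x^T) 0 0 = nz.
    by rewrite -mulmxA -[B in LHS]Bsym -trmx_mul.
  have -> : (x - t *: z)^T = x^T - t *: z^T by rewrite linearB /= linearZ.
  rewrite !mulmxBl (mulmxBr (x *m B)) (mulmxBr (_ *: z *m B)).
  rewrite -!scalemxAl -!scalemxAr.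
  move: Bx0; rewrite -/z !mxE => ->; move: zx; rewrite /nz /c !mxE => -> ; ring.
have ineq (t : R) : 0 <= - 2 * t * nz + t ^+ 2 * c by rewrite -expand.
have c0 : 0 <= c := B_ge0 z.
rewrite leNgt; apply/negP => nz_gt0.
have c1 : 0 < c + 1 by lra.
(* The quadratic is least at nz / c; the added 1 keeps the denominator positive when c = 0. *)
have := ineq (nz / (c + 1)).
have -> : - 2 * (nz / (c + 1)) * nz + (nz / (c + 1)) ^+ 2 * c =
   - (nz ^+ 2 * (c + 2) / (c + 1) ^+ 2) by field; rewrite gt_eqF.
rewrite oppr_ge0 leNgt divr_gt0 // ?exprn_gt0 //.
by rewrite mulr_gt0 ?exprn_gt0 //; lra.
Qed.

(** The unit sphere is closed in the cube [-1, 1]^n, hence compact, so the continuous form attains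
    its maximum there; homogeneity extends the bound to all [y]. *)
Lemma rayleigh_max_exists (R : realType) n (A : 'M[R]_n) : (0 < n)%N ->
  exists x : 'rV[R]_n, (x *m x^T) 0 0 = 1 /\
    forall y : 'rV_n, (y *m A *m y^T) 0 0 <= (x *m A *m x^T) 0 0 * (y *m y^T) 0 0.
Proof.
case: n A => // n A _.
pose S : set 'rV[R]_n.+1 := [set x | (x *m x^T) 0 0 = 1]%classic.
have form_cont (M : 'M[R]_n.+1) : continuous (fun x : 'rV[R]_n.+1 => (x *m M *m x^T) 0 0).
  rewrite (_ : (fun x => _) =
    (fun x : 'rV[R]_n.+1 => \sum_j (\sum_i x 0 i * M i j) * x 0 j)); last first.
    by apply/boolp.funext => x; rewrite mxE; under eq_bigr do rewrite !mxE.
  have addc : continuous (fun z : R * R => z.1 + z.2) by exact: add_continuous.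
  have row_cont j : continuous (fun x : 'rV[R]_n.+1 => \sum_i x 0 i * M i j).
    apply: (continuous_big addc) => i _ x.
    by apply: cvgM; [exact: nbhs_filter|exact: coord_continuous|apply: cvg_cst; exact: nbhs_filter].
  apply: (continuous_big addc) => j _ x.
  by apply: cvgM; [exact: nbhs_filter|exact: row_cont|exact: coord_continuous].
have nrm_cont : continuous (fun x : 'rV[R]_n.+1 => (x *m x^T) 0 0).
  rewrite (_ : (fun x => _) = fun x => (x *m 1%:M *m x^T) 0 0); first exact: form_cont.
  by apply/boolp.funext => x; rewrite mulmx1.
have S_compact : compact S.
  apply: (@subclosed_compact _ _
      [set v : 'rV[R]_n.+1 | forall i, `[(-1 : R), 1]%classic (v ord0 i)]%classic).
  - rewrite (_ : S = (fun x : 'rV[R]_n.+1 => (x *m x^T) 0 0) @^-1` [set 1]%classic)%classic //.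
    by apply: closed_comp; [move=> x _; exact: nrm_cont | exact: closed_eq].
  - by apply: (@rV_compact _ _ (fun=> `[(-1 : R), 1]%classic)) => i; exact: segment_compact.
  - move=> x; rewrite /S /= mulmx_tr_sqr => x1 i; rewrite in_itv /= -ler_norml.
    rewrite -(@ler_pXn2r _ 2) ?nnegrE // expr1n real_normK ?num_real // -x1.
    by rewrite (bigD1 i) //= lerDl sumr_ge0 // => j _; exact: sqr_ge0.
have S_nonempty : (S !=set0)%classic.
  exists (delta_mx 0 0); rewrite /S /= mulmx_tr_sqr (bigD1 0) //= big1 => [|i i0].
    by rewrite !mxE !eqxx /= expr1n addr0.
  by rewrite !mxE eqxx /= (negbTE i0) expr0n.
have [x xS xmax] := EVT_max_rV S_nonempty S_compact (continuous_subspaceT (form_cont A)).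
rewrite inE in xS; exists x; split=> // y.
have [y0|y_neq0] := eqVneq y 0; first by rewrite y0 !mul0mx mxE mulr0.
set N := (y *m y^T) 0 0.
have N_gt0 : 0 < N.
  by rewrite ltNge; apply: contra y_neq0; rewrite /N mulmx_tr_sqr => /rV_sqr_eq0 ->.
have sN_gt0 : 0 < Num.sqrt N by rewrite sqrtr_gt0.
have scale (M : 'M[R]_n.+1) : (((Num.sqrt N)^-1 *: y) *m M *m ((Num.sqrt N)^-1 *: y)^T) 0 0
    = (y *m M *m y^T) 0 0 / N.
  rewrite linearZ /= -!scalemxAl -!scalemxAr scalerA mxE mulrC -expr2 exprVn sqr_sqrtr //.
  exact: ltW.
have := xmax ((Num.sqrt N)^-1 *: y); rewrite inE /S /= scale ler_pdivrMr //; apply.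
by have := scale 1%:M; rewrite !mulmx1 => ->; rewrite divff // gt_eqF.
Qed.

(* Each edge is counted twice, so this is twice the signless Laplacian form. *)
Definition edge_form (R : pzSemiRingType) (T : finType) (e : rel T) (x : T -> R) : R :=
  \sum_i \sum_j (e i j)%:R * (x i + x j) ^+ 2.

Lemma deg_sum (R : pzSemiRingType) (T : finType) (e : rel T) (x : T) :
  (deg e x)%:R = \sum_y (e x y)%:R :> R.
Proof.
rewrite /deg -sum1dep_card natr_sum big_mkcond.
by apply: eq_bigr => y _; case: (e x y).
Qed.

Lemma mulmx_signless (R : comNzRingType) n (e : rel 'I_n) (x : 'rV[R]_n) i :
  symmetric e ->
  (x *m signless_laplacian R e) 0 i = \sum_j (e i j)%:R * (x 0 i + x 0 j).
Proof.
move=> e_sym; rewrite mxE.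
under eq_bigr do rewrite mxE mulrDr.
rewrite big_split /= (bigD1 i) //= eqxx big1 ?addr0 => [|j /negbTE ji]; last first.
  by rewrite ji mulr0.
under [RHS]eq_bigr do rewrite mulrDr.
rewrite [RHS]big_split /= -mulr_suml -deg_sum mulrC; congr (_ + _).
by apply: eq_bigr => j _; rewrite e_sym; case: (e i j); rewrite ?mulr1 ?mulr0 ?mul1r ?mul0r.
Qed.

Lemma signless_form (R : realFieldType) n (e : rel 'I_n) (x : 'rV[R]_n) :
  symmetric e ->
  2 * (x *m signless_laplacian R e *m x^T) 0 0 = edge_form e (x 0).
Proof.
move=> e_sym; rewrite mxE.
under eq_bigr => i _ do rewrite mulmx_signless // [x^T _ _]mxE mulrC mulr_sumr.
rewrite mulr_natl mulr2n [X in X + _]exchange_big -big_split; apply: eq_bigr => i _ /=.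
rewrite -big_split; apply: eq_bigr => j _ /=; rewrite e_sym; ring.
Qed.

Lemma signless_sym (R : nzRingType) n (e : rel 'I_n) :
  symmetric e -> (signless_laplacian R e)^T = signless_laplacian R e.
Proof.
move=> e_sym; apply/matrixP => i j; rewrite !mxE eq_sym e_sym.
by case: eqP => // ->.
Qed.

(** Absolute values keep the norm, so this makes a nonnegative maximiser available. *)
Lemma edge_form_le_norm (R : realDomainType) (T : finType) (e : rel T) (x : T -> R) :
  edge_form e x <= edge_form e (fun i => `|x i|).
Proof.
apply: ler_sum => i _; apply: ler_sum => j _; apply: ler_wpM2l; first exact: ler0n.
by rewrite -(real_normK (num_real (_ + _))) lerXn2r ?nnegrE ?addr_ge0 ?ler_normD.
Qed.

(** The entrywise absolute value of a maximiser of the Rayleigh quotient is again a maximiser, hence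
    an eigenvector. Here [q] is that maximum. *)
Lemma perron_signless (R : realType) n (e : rel 'I_n) : (0 < n)%N -> symmetric e ->
  exists (q : R) (x : 'I_n -> R),
    [/\ forall i, 0 <= x i, \sum_i x i ^+ 2 = 1,
        edge_form e x = 2 * q,
        forall y, edge_form e y <= 2 * q * \sum_i y i ^+ 2
      & forall i, q * x i = \sum_j (e i j)%:R * (x i + x j)].
Proof.
move=> n_gt0 e_sym; set A := signless_laplacian R e.
have [z [z1 zmax]] := rayleigh_max_exists A n_gt0; set q := (z *m A *m z^T) 0 0 in zmax.
have formE (y : 'I_n -> R) : 2 * ((\row_i y i) *m A *m (\row_i y i)^T) 0 0 = edge_form e y.
  by rewrite signless_form //; apply: eq_bigr => i _; apply: eq_bigr => j _; rewrite !mxE.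
have normE (y : 'I_n -> R) : ((\row_i y i) *m (\row_i y i)^T) 0 0 = \sum_i y i ^+ 2.
  by rewrite mulmx_tr_sqr; apply: eq_bigr => i _; rewrite mxE.
have le_q y : edge_form e y <= 2 * q * \sum_i y i ^+ 2.
  by rewrite -formE -normE -mulrA ler_pM2l.
pose x i := `|z 0 i|.
have x1 : \sum_i x i ^+ 2 = 1.
  by rewrite -z1 mulmx_tr_sqr; apply: eq_bigr => i _; rewrite /x real_normK ?num_real.
have xq : edge_form e x = 2 * q.
  apply/eqP; rewrite eq_le; have := le_q x; rewrite x1 mulr1 => -> /=.
  by rewrite /q signless_form // edge_form_le_norm.
exists q, x; split=> // [i|i]; first exact: normr_ge0.
have : (\row_i x i) *m A = q *: \row_i x i.
  apply: rayleigh_max_eigen => //; first exact: signless_sym.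
  by apply: (mulfI (x := 2)); rewrite ?pnatr_eq0 // formE normE x1 mulr1.
move=> /matrixP/(_ 0 i); rewrite mulmx_signless // !mxE => <-.
by apply: eq_bigr => j _; rewrite !mxE.
Qed.

(** Positivity rules out that the maximum is only the default value 0. *)
Lemma bigmax0_mem (R : realDomainType) (s : seq R) :
  0 < \big[Num.max/0]_(x <- s) x -> \big[Num.max/0]_(x <- s) x \in s.
Proof.
elim: s => [|a s IHs]; first by rewrite big_nil ltxx.
rewrite big_cons inE; set M := \big[_/_]_(x <- s) x in IHs *.
case: (leP a M) => _ M_gt0; last by rewrite eqxx.
by rewrite IHs ?orbT.
Qed.

(** The bridge from the characteristic polynomial to the edge form: a positive [q_signless] is a
    genuine root, and an eigenvector for it is normalised. *)
Lemma q_signless_vector (R : rcfType) n (e : rel 'I_n) : symmetric e ->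
  0 < q_signless R e ->
  exists2 x : 'I_n -> R, \sum_i x i ^+ 2 = 1 & edge_form e x = 2 * q_signless R e.
Proof.
move=> e_sym q_gt0; set q := q_signless R e.
have : root (char_poly (signless_laplacian R e)) q.
  have p_neq0 : char_poly (signless_laplacian R e) != 0 by rewrite monic_neq0 ?char_poly_monic.
  have := bigmax0_mem q_gt0; rewrite -/(q_signless R e) -/q.
  by rewrite -roots_on_rootsR // => /andP[].
rewrite -eigenvalue_root_char => /eigenvalueP[v vA v_neq0].
pose N := \sum_i v 0 i ^+ 2.
have N_gt0 : 0 < N by rewrite ltNge; apply: contra v_neq0 => /rV_sqr_eq0 ->.
have sN2 : Num.sqrt N ^+ 2 = N by rewrite sqr_sqrtr // ltW.
exists (fun i => v 0 i / Num.sqrt N).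
  under eq_bigr do rewrite exprMn exprVn sN2.
  by rewrite -mulr_suml divff // gt_eqF.
have -> : edge_form e (fun i => v 0 i / Num.sqrt N) = edge_form e (v 0) / N.
  rewrite /edge_form mulr_suml; apply: eq_bigr => i _; rewrite mulr_suml.
  by apply: eq_bigr => j _; rewrite -mulrDl exprMn exprVn sN2 mulrA.
rewrite -signless_form // vA -scalemxAl mxE mulmx_tr_sqr -/N.
by rewrite mulrA mulfK // gt_eqF.
Qed.

(** * Deleting a vertex with least Perron entry *)

(** The vertex type is kept and vertices outside [S] become isolated, so vectors and sums range over
    one fixed type while vertices are deleted. *)
Definition induced (T : finType) (e : rel T) (S : {set T}) : rel T :=
  fun i j => [&& i \in S, j \in S & e i j].

Lemma induced_sym (T : finType) (e : rel T) (S : {set T}) :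
  symmetric e -> symmetric (induced e S).
Proof. by move=> e_sym i j; rewrite /induced e_sym andbCA. Qed.

Lemma deg_induced (T : finType) (e : rel T) (S : {set T}) v :
  v \in S -> deg (induced e S) v = #|[set y in S | e v y]|.
Proof. by move=> vS; apply: eq_card => y; rewrite !inE /induced vS. Qed.

Lemma deg_induced_le (T : finType) (e : rel T) (S : {set T}) v :
  (deg (induced e S) v <= #|S|)%N.
Proof. by apply/subset_leq_card/fintype.subsetP => y; rewrite inE => /and3P[]. Qed.

(** Uses (a + b)^2 <= 2 a^2 + 2 b^2 on each edge. For G[S] it yields q <= 2 |S|. *)
Lemma edge_form_le_deg (R : realDomainType) (T : finType) (g : rel T) (s : nat) (x : T -> R) :
  symmetric g -> (forall v, (deg g v <= s)%N) ->
  edge_form g x <= 4 * s%:R * \sum_i x i ^+ 2.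
Proof.
move=> g_sym g_deg.
have deg_part : \sum_i \sum_j (g i j)%:R * x i ^+ 2 <= s%:R * \sum_i x i ^+ 2.
  rewrite mulr_sumr; apply: ler_sum => i _; rewrite -mulr_suml -deg_sum.
  by rewrite ler_wpM2r ?sqr_ge0 // ler_nat.
apply: (@le_trans _ _ (4 * \sum_i \sum_j (g i j)%:R * x i ^+ 2)); last first.
  by rewrite -mulrA ler_pM2l.
have -> : 4 * (\sum_i \sum_j (g i j)%:R * x i ^+ 2) =
    2 * (\sum_i \sum_j (g i j)%:R * x i ^+ 2 + \sum_i \sum_j (g i j)%:R * x j ^+ 2).
  rewrite [X in _ = 2 * (_ + X)]exchange_big /=.
  under [X in _ = 2 * (_ + X)]eq_bigr do under eq_bigr do rewrite g_sym.
  by ring.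
rewrite -big_split mulr_sumr; apply: ler_sum => i _ /=.
rewrite -big_split mulr_sumr; apply: ler_sum => j _ /=.
rewrite -mulrDr [leRHS]mulrCA; apply: ler_wpM2l; first exact: ler0n.
by have := sqr_ge0 (x i - x j); nra.
Qed.

Lemma edge_form_delete (R : comNzRingType) (T : finType) (e : rel T) (S : {set T})
    (u : T) (x : T -> R) :
  symmetric e -> irreflexive e ->
  edge_form (induced e (S :\ u)) x =
  edge_form (induced e S) x - 2 * \sum_j (induced e S u j)%:R * (x u + x j) ^+ 2.
Proof.
move=> e_sym e_irr; set g := induced e S.
pose F i j := (g i j)%:R * (x i + x j) ^+ 2.
have g_sym : symmetric g by exact: induced_sym.
have -> : \sum_j (g u j)%:R * (x u + x j) ^+ 2 = \sum_j F u j by [].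
have split_u : edge_form g x = edge_form (induced e (S :\ u)) x
    + \sum_i \sum_j (i == u)%:R * F u j + \sum_i \sum_j (j == u)%:R * F u i.
  rewrite -!big_split; apply: eq_bigr => i _ /=.
  rewrite -!big_split; apply: eq_bigr => j _ /=.
  rewrite -/(F i j); have gE : induced e (S :\ u) i j = [&& i != u, j != u & g i j].
    by rewrite /g /induced !inE -!andbA; case: (i != u) => //=; case: (i \in S) => //=; rewrite andbF.
  rewrite gE; have [->|iu] := eqVneq i u.
    rewrite mul0r add0r mul1r; have [->|_] := eqVneq j u; last by rewrite mul0r addr0.
    by rewrite /F /g /induced e_irr !andbF !mul0r mulr0 addr0.
  rewrite mul0r addr0; have [->|ju] := eqVneq j u; last by rewrite mul0r addr0.
  by rewrite mul0r add0r mul1r /F g_sym addrC.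
rewrite split_u [in X in _ + X - _]exchange_big /=.
have delta (G : T -> R) : \sum_i \sum_j (i == u)%:R * G j = \sum_j G j.
  rewrite (bigD1 u) //= eqxx [X in _ + X]big1 ?addr0; first by apply: eq_bigr => j _; rewrite mul1r.
  by move=> i /negbTE ->; rewrite big1 // => j _; rewrite mul0r.
rewrite !delta; ring.
Qed.

(** Every vertex of [S] that is not a neighbour of [u], including [u] when it lies in [S] and has no
    loop, contributes at least m^2. *)
Lemma nbr_sqr_sum_le (R : realDomainType) (T : finType) (e : rel T) (S : {set T})
    (x : T -> R) (m : R) (u : T) :
  0 <= m -> (forall i, i \in S -> m <= x i) ->
  \sum_j (induced e S u j)%:R * x j ^+ 2 + (#|S|%:R - (deg (induced e S) u)%:R) * m ^+ 2
  <= \sum_j x j ^+ 2.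
Proof.
move=> m_ge0 mx; rewrite deg_sum.
have -> : #|S|%:R = \sum_j (j \in S)%:R :> R.
  by rewrite -sum1_card natr_sum big_mkcond; apply: eq_bigr => j _; case: (j \in S).
rewrite -sumrB mulr_suml -big_split; apply: ler_sum => j _ /=.
have [jS|jS] := boolP (j \in S); last first.
  by rewrite /induced (negbTE jS) andbF subrr !mul0r addr0 sqr_ge0.
have : m ^+ 2 <= x j ^+ 2 by rewrite lerXn2r ?nnegrE ?mx // (le_trans m_ge0) ?mx.
by case: (induced e S u j); rewrite /= ?subrr ?subr0 ?mul0r ?mul1r ?addr0 ?add0r.
Qed.

Section DeleteMin.
Variables (R : realFieldType) (T : finType) (e : rel T) (S : {set T}).
Variables (x : T -> R) (q m : R).
Hypotheses (m_ge0 : 0 <= m) (mx : forall i, i \in S -> m <= x i).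
Hypothesis x1 : \sum_i x i ^+ 2 = 1.
Hypothesis eig : forall i, q * x i = \sum_j (induced e S i j)%:R * (x i + x j).

Lemma eigen_nbr_sum u :
  \sum_j (induced e S u j)%:R * x j = (q - (deg (induced e S) u)%:R) * x u.
Proof.
rewrite mulrBl eig; under [X in _ = X - _]eq_bigr do rewrite mulrDr.
by rewrite big_split /= -mulr_suml -deg_sum [RHS]addrC addKr.
Qed.

(* Expand 0 <= sum_(j ~ v) (x_j - m)^2 and insert the eigenvalue equation at v. *)
Lemma min_entry_le v : v \in S -> q >= (deg (induced e S) v)%:R ->
  m ^+ 2 * (2 * q - 4 * (deg (induced e S) v)%:R + #|S|%:R) <= 1.
Proof.
move=> vS qd.
have sq_ge0 : 0 <= \sum_j (induced e S v j)%:R * (x j - m) ^+ 2.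
  by apply: sumr_ge0 => j _; rewrite mulr_ge0 ?ler0n ?sqr_ge0.
have sqE : \sum_j (induced e S v j)%:R * (x j - m) ^+ 2 =
    \sum_j (induced e S v j)%:R * x j ^+ 2
    - 2 * m * (\sum_j (induced e S v j)%:R * x j) + (deg (induced e S) v)%:R * m ^+ 2.
  rewrite deg_sum mulr_sumr mulr_suml -sumrB -big_split.
  by apply: eq_bigr => j _ /=; ring.
have := nbr_sqr_sum_le e v m_ge0 mx; rewrite x1.
rewrite sqE eigen_nbr_sum in sq_ge0.
have : m * (q - (deg (induced e S) v)%:R) * (x v - m) >= 0.
  by rewrite !mulr_ge0 ?subr_ge0 ?mx.
move: sq_ge0; clear; set d := (deg _ _)%:R; set X := \sum_j _; nra.
Qed.

(** With d the degree of [u], the edges at [u] carry d m^2 + 2 (q - d) m^2 plus the neighbours'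
    squares, which are at most 1 - (|S| - d) m^2. The degree cancels from the sum. *)
Lemma edge_form_delete_min u : symmetric e -> irreflexive e -> u \in S -> x u = m ->
  edge_form (induced e S) x = 2 * q ->
  2 * (q - 1 - (2 * q - #|S|%:R) * m ^+ 2) <= edge_form (induced e (S :\ u)) x.
Proof.
move=> e_sym e_irr uS xu xq; rewrite edge_form_delete // xq xu.
have -> : \sum_j (induced e S u j)%:R * (m + x j) ^+ 2 =
    (deg (induced e S) u)%:R * m ^+ 2 + 2 * m * (\sum_j (induced e S u j)%:R * x j)
    + \sum_j (induced e S u j)%:R * x j ^+ 2.
  rewrite deg_sum mulr_sumr mulr_suml -!big_split.
  by apply: eq_bigr => j _ /=; ring.
rewrite eigen_nbr_sum xu; have := nbr_sqr_sum_le e u m_ge0 mx; rewrite x1.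
set d := (deg _ _)%:R; set X := \sum_j _; nra.
Qed.

End DeleteMin.

(** Here [mm] stands for the squared least entry, and 1 - mm is the squared norm left after
    deletion. With p = q / s, the difference of the two sides is at least (p - 1)(1 - s mm) - gam -
    p mm + gam mm. The first product is at least 2 gam, because p - 1 >= 2 eps and 1 - s mm >= 2 eps
    / (1 + 2 eps), and p mm <= 2 mm <= gam. *)
Lemma delete_gain (R : realFieldType) (a eps gam q s d mm tau : R) :
  0 < eps -> 2^-1 <= a -> gam = 2 * eps ^+ 2 / (1 + 2 * eps) ->
  2 + (1 + 2 * eps) / eps ^+ 2 <= s -> 2 * (a + eps) <= tau -> tau * s <= q -> q <= 2 * s ->
  d <= (a + eps / 2) * s -> 0 <= mm -> mm * (2 * q - 4 * d + s) <= 1 ->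
  mm < 1 /\ (tau * (s - 1) + gam) * (1 - mm) <= q - 1 - (2 * q - s) * mm.
Proof.
move=> eps_gt0 a_ge gamE s_ge tau_ge q_ge q_le d_le mm_ge0 mm_le.
have e2_gt0 : 0 < eps ^+ 2 by rewrite exprn_gt0.
have c_gt0 : 0 < 1 + 2 * eps by lra.
have s_gt2 : 2 < s by apply: lt_le_trans s_ge; rewrite ltrDl divr_gt0.
have s_eps : 1 + 2 * eps <= s * eps ^+ 2.
  by rewrite -ler_pdivrMr //; lra.
have smm : s * mm * (1 + 2 * eps) <= 1.
  have : 2 * q - 4 * d >= 2 * eps * s by nra.
  nra.
have smm1 : s * mm <= 1 by nra.
have mm_lt1 : mm < 1 by nra.
split=> //.
have gam_gt0 : 0 < gam by rewrite gamE divr_gt0 // mulr_gt0.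
have gamM : gam * (1 + 2 * eps) = 2 * eps ^+ 2 by rewrite gamE divfK // gt_eqF.
pose p := q / s.
have qE : q = p * s by rewrite divfK // gt_eqF //; lra.
have s_gt0 : 0 < s by lra.
have p_ge : tau <= p by rewrite ler_pdivlMr.
have p_le : p <= 2 by rewrite ler_pdivrMr.
clearbody p; subst q; clear gamE q_ge q_le d_le mm_le s_ge.
apply: (@le_trans _ _ ((p * (s - 1) + gam) * (1 - mm))).
  by rewrite ler_wpM2r; lra || (rewrite lerD2r ler_wpM2r; lra).
rewrite -subr_ge0.
have -> : p * s - 1 - (2 * (p * s) - s) * mm - (p * (s - 1) + gam) * (1 - mm) =
   (p - 1) * (1 - s * mm) - gam - p * mm + gam * mm by ring.
have theta : 2 * eps <= (1 - s * mm) * (1 + 2 * eps) by nra.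
(* The lower bound on [s] is chosen for this estimate. *)
have mm_gam : 2 * mm <= gam.
  have h1 : mm * (1 + 2 * eps) * (1 + 2 * eps) <= eps ^+ 2.
    have : mm * (1 + 2 * eps) * (1 + 2 * eps) <= mm * (1 + 2 * eps) * (s * eps ^+ 2).
      by rewrite ler_wpM2l // mulr_ge0 // ltW.
    nra.
  have h2 : mm * (1 + 2 * eps) <= mm * (1 + 2 * eps) * (1 + 2 * eps).
    by rewrite ler_peMr ?mulr_ge0 //; lra.
  have : 2 * mm * (1 + 2 * eps) <= gam * (1 + 2 * eps) by lra.
  by rewrite ler_pM2r.
have gain : 2 * gam <= (p - 1) * (1 - s * mm).
  have : 2 * gam * (1 + 2 * eps) <= (p - 1) * (1 - s * mm) * (1 + 2 * eps).
    have : 2 * eps <= p - 1 by lra.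
    nra.
  by rewrite ler_pM2r.
have : p * mm <= 2 * mm by rewrite ler_wpM2r.
have : 0 <= gam * mm by rewrite mulr_ge0 // ltW.
lra.
Qed.

(** * Passing to large minimum degree *)

(* q(G[S]) >= tau |S|, phrased with a test vector. *)
Definition dense_on (R : realFieldType) (T : finType) (e : rel T) (S : {set T}) (tau : R) :=
  (0 < #|S|)%N /\ exists x : T -> R, 0 < \sum_i x i ^+ 2 /\
    2 * (tau * #|S|%:R) * \sum_i x i ^+ 2 <= edge_form (induced e S) x.

Lemma dense_on_le (R : realFieldType) (T : finType) (e : rel T) (S : {set T}) (t1 t2 : R) :
  t1 <= t2 -> dense_on e S t2 -> dense_on e S t1.
Proof.
move=> t12 [S_gt0 [x [x_gt0 xt]]]; split=> //; exists x; split=> //.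
by apply: le_trans xt; rewrite ler_wpM2r ?(ltW x_gt0) // ler_wpM2l // ler_wpM2r ?ler0n.
Qed.

(** Set against the accumulated gains, this cap keeps the surviving set large. *)
Lemma dense_on_le2 (R : realFieldType) (T : finType) (e : rel T) (S : {set T}) (tau : R) :
  symmetric e -> dense_on e S tau -> tau <= 2.
Proof.
move=> e_sym [S_gt0 [x [x_gt0 xt]]].
have := le_trans xt (edge_form_le_deg x (induced_sym _ e_sym) (deg_induced_le e S)).
rewrite ler_pM2r //.
have : 0 < #|S|%:R :> R by rewrite ltr0n.
nra.
Qed.

Lemma dense_on_delete (R : realType) n (e : rel 'I_n) (S : {set 'I_n}) (a eps gam tau : R) v :
  symmetric e -> irreflexive e ->
  0 < eps -> 2^-1 <= a -> gam = 2 * eps ^+ 2 / (1 + 2 * eps) ->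
  2 + (1 + 2 * eps) / eps ^+ 2 <= #|S|%:R -> 2 * (a + eps) <= tau ->
  dense_on e S tau -> v \in S -> (deg (induced e S) v)%:R <= (a + eps / 2) * #|S|%:R ->
  exists2 u, u \in S & dense_on e (S :\ u) (tau + gam / (#|S|%:R - 1)).
Proof.
move=> e_sym e_irr eps_gt0 a_ge gamE S_ge tau_ge [S_gt0 [z [z_gt0 zt]]] vS v_deg.
set s : R := #|S|%:R in S_ge zt v_deg *.
have n_gt0 : (0 < n)%N by case: n v {e S z e_sym e_irr S_ge vS v_deg S_gt0 z_gt0 zt s} => // -[].
have [q [x [x_ge0 x1 xq q_max eig]]] := perron_signless R n_gt0 (induced_sym S e_sym).
have q_ge : tau * s <= q.
  by have := le_trans zt (q_max z); rewrite ler_pM2r // ler_pM2l.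
have q_le : q <= 2 * s.
  have := edge_form_le_deg x (induced_sym _ e_sym) (deg_induced_le e S).
  by rewrite xq x1 -/s; lra.
have s_gt0 : 0 < s by rewrite /s ltr0n.
have [u uS u_min] : exists2 u, u \in S & forall i, i \in S -> x u <= x i.
  by case: (@arg_minP _ _ _ v (mem S) x vS) => u uS umin; exists u.
have q_deg : (deg (induced e S) v)%:R <= q.
  have : (deg (induced e S) v)%:R <= s by rewrite ler_nat deg_induced_le.
  nra.
have mm_le := min_entry_le (x_ge0 u) u_min x1 eig vS q_deg.
have del := edge_form_delete_min (x_ge0 u) u_min x1 eig e_sym e_irr uS erefl xq.
have [mm_lt1 gain] := delete_gain eps_gt0 a_ge gamE S_ge tau_ge q_ge q_le v_deg (sqr_ge0 (x u)) mm_le.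
have s_gt2 : 2 < s.
  by apply: lt_le_trans S_ge; rewrite ltrDl divr_gt0 ?exprn_gt0 //; lra.
exists u => //; have cardSu : #|S| = #|S :\ u|.+1 by rewrite (cardsD1 u S) uS.
have sE : #|S :\ u|%:R = s - 1 by rewrite /s cardSu -natr1 addrK.
split; first by rewrite -(ltr0n R) sE; lra.
(* The test vector is the Perron vector with its entry at [u] set to 0; the form is unchanged, as
   [u] is isolated in the smaller graph. *)
pose y i := if i == u then 0 else x i.
have yE : \sum_i y i ^+ 2 = 1 - x u ^+ 2.
  rewrite -x1 [in RHS](bigD1 u) //= [RHS]addrC addKr (bigD1 u) //= /y eqxx expr0n add0r.
  by apply: eq_bigr => i /negbTE ->.
have yF : edge_form (induced e (S :\ u)) y = edge_form (induced e (S :\ u)) x.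
  apply: eq_bigr => i _; apply: eq_bigr => j _; rewrite /y /induced !inE.
  by case: eqP => [_|_]; rewrite ?mul0r //=; case: eqP; rewrite ?andbF ?mul0r.
exists y; rewrite yE subr_gt0 mm_lt1 yF sE; split=> //.
apply: le_trans del.
have -> : (tau + gam / (s - 1)) * (s - 1) = tau * (s - 1) + gam.
  by rewrite mulrDl divfK // gt_eqF //; lra.
by rewrite -mulrA ler_pM2l.
Qed.

(** Induction on |S|, deleting while a low degree vertex exists. The logarithm in [tau] records the
    accumulated gains, and the premise on [tau]-dense sets keeps every set met above the size that a
    deletion requires. *)
Lemma dense_min_degree (R : realType) n (e : rel 'I_n) (a eps gam tau0 : R) (S : {set 'I_n}) :
  symmetric e -> irreflexive e ->
  0 < eps -> 2^-1 <= a -> gam = 2 * eps ^+ 2 / (1 + 2 * eps) -> 2 * (a + eps) <= tau0 ->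
  let tau (S : {set 'I_n}) := tau0 + gam * (ln n%:R - ln #|S|%:R) in
  (forall S, dense_on e S (tau S) -> 2 + (1 + 2 * eps) / eps ^+ 2 <= #|S|%:R) ->
  dense_on e S (tau S) ->
  exists2 S' : {set 'I_n}, dense_on e S' (tau S') &
    forall v, v \in S' -> (a + eps / 2) * #|S'|%:R < (deg (induced e S') v)%:R.
Proof.
move=> e_sym e_irr eps_gt0 a_ge gamE tau0_ge tau large.
have [m] := ubnP #|S|; elim: m S => // m IHm S leSm dS.
have [/existsP[v /andP[vS v_deg]]|no_low] := boolP
    [exists v in S, (deg (induced e S) v)%:R <= (a + eps / 2) * #|S|%:R]; last first.
  exists S => // v vS; rewrite ltNge; apply: contra no_low => low.
  by apply/existsP; exists v; rewrite vS.
have gam_gt0 : 0 < gam by rewrite gamE divr_gt0 ?mulr_gt0 ?exprn_gt0 //; lra.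
have s_ge := large S dS.
have s_gt2 : 2 < #|S|%:R :> R.
  by apply: lt_le_trans s_ge; rewrite ltrDl divr_gt0 ?exprn_gt0 //; lra.
have tau_ge : 2 * (a + eps) <= tau S.
  apply: le_trans tau0_ge _; rewrite lerDl mulr_ge0 ?(ltW gam_gt0) // subr_ge0.
  have leSn : #|S|%:R <= n%:R :> R by rewrite ler_nat -[leqRHS]card_ord max_card.
  by rewrite ler_ln ?posrE //; lra.
have [u uS dSu] := dense_on_delete e_sym e_irr eps_gt0 a_ge gamE s_ge tau_ge dS vS v_deg.
have cardSu : #|S| = #|S :\ u|.+1 by rewrite (cardsD1 u S) uS.
apply: (IHm (S :\ u)); first by rewrite -ltnS -cardSu.
(* The gain gam / (s - 1) covers the increase gam (ln s - ln (s - 1)) of [tau], by ln (1 + 1 / r) <=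
   1 / r with r = s - 1. *)
apply: dense_on_le dSu; rewrite /tau -addrA lerD2l -mulrDr ler_pM2l //.
have sE : #|S|%:R = #|S :\ u|%:R + 1 :> R by rewrite cardSu natr1.
rewrite sE addrK; set r : R := #|S :\ u|%:R in sE *.
have r_gt0 : 0 < r by lra.
have : ln (r + 1) - ln r <= r^-1.
  rewrite -ln_div ?posrE //; last by lra.
  rewrite mulrDl divff ?gt_eqF // mul1r le_ln1Dx //.
  by rewrite (lt_trans _ (_ : 0 < _)) ?invr_gt0 //; lra.
lra.
Qed.

(** * Choice of the constants and conclusion *)

(** Both roundings cost at most 1 in total: ln s <= (L + 1) ln 2 <= L + 1 <= (t + 1) D. *)
Lemma trunc_log_div_ge (R : realType) (s D : nat) : (0 < s)%N -> (0 < D)%N ->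
  ln s%:R / D%:R - 1 <= (trunc_log 2 s %/ D)%:R :> R.
Proof.
move=> s_gt0 D_gt0; set L := trunc_log 2 s; set t := (L %/ D)%N.
have D_gt0R : 0 < D%:R :> R by rewrite ltr0n.
rewrite lerBlDr ler_pdivrMr //.
have L_lt : (L.+1 <= t.+1 * D)%N by rewrite ltn_ceil.
apply: (@le_trans _ _ L.+1%:R); last by rewrite natr1 -natrM ler_nat.
have s_lt : s%:R <= 2 ^+ L.+1 :> R by rewrite -natrX ler_nat ltnW // trunc_log_ltn.
apply: (@le_trans _ _ (ln (2 ^+ L.+1))).
  by rewrite ler_ln ?posrE ?ltr0n ?exprn_gt0.
rewrite lnXn // -[leLHS]mulr_natl ler_piMr ?ler0n //.
by have := @le_ln1Dx R 1; rewrite -[1 + 1]/2; apply; lra.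
Qed.

Theorem theorem2p3 (R : realType) (k : nat) (eps : R) :
  (2 <= k)%N -> 0 < eps ->
  exists c : R, 0 < c /\
  exists n0 : nat, forall (n : nat) (G : rel 'I_n),
    (n0 <= n)%N -> simple_graph G ->
    q_signless R G >= (1 - k%:R^-1 + eps) * (2 * n%:R) ->
    exists t : nat, (0 < t)%N /\ c * ln (n%:R : R) <= t%:R /\
      contains_copy (@blowup _ (@complete_graph k.+1) t) G.
Proof.
move=> k_ge2 eps_gt0; pose a : R := 1 - k%:R^-1.
have kR_gt0 : 0 < k%:R :> R by rewrite ltr0n; lia.
have a_ge : 2^-1 <= a.
  by rewrite /a lerBrDl -lerBrDr (_ : 1 - 2^-1 = 2^-1) ?lef_pV2 ?posrE ?ler_nat //; lra.
pose gam : R := 2 * eps ^+ 2 / (1 + 2 * eps).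
have gam_gt0 : 0 < gam by rewrite divr_gt0 ?mulr_gt0 ?exprn_gt0 //; lra.
pose M : R := 2 + (1 + 2 * eps) / eps ^+ 2.
have M_gt2 : 2 < M by rewrite ltrDl divr_gt0 ?exprn_gt0 //; lra.
(* Ensures 2 / s <= eps / 2, so the minimum degree reaches (1 - 1/k + 2/s) |S|. *)
pose s := (Num.truncn (4 / eps)).+1.
have s_eps : 4 <= s%:R * eps by rewrite -ler_pdivrMr // ltW // truncnS_gt.
pose D := (2 * k * s ^ k)%N.
have D_gt0 : (0 < D)%N by rewrite !muln_gt0 expn_gt0 /=; lia.
have DR_gt0 : 0 < D%:R :> R by rewrite ltr0n.
have lnM_ge0 : 0 <= ln M by rewrite ln_ge0 //; lra.
(* The summands make, in turn, ln n - 1 / gam >= ln n / 2, ln n / 2 >= ln M and ln n / (4 D) >=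
   1. *)
pose K : R := 2 / gam + 2 * ln M + 4 * D%:R.
have gamV_gt0 : 0 < gam^-1 by rewrite invr_gt0.
exists (4 * D%:R)^-1; split; first by rewrite invr_gt0 mulr_gt0.
exists (Num.truncn (expR K)).+1 => n G n_ge [G_irr G_sym] q_ge.
have n_K : expR K < n%:R.
  by apply: lt_le_trans (truncnS_gt _) _; rewrite ler_nat.
have n_gt0R : 0 < n%:R :> R by apply: lt_trans n_K; exact: expR_gt0.
have ln_n : K <= ln n%:R by rewrite -[K]expRK ler_ln ?posrE ?expR_gt0 // ltW.
have n_gt0 : (0 < n)%N by rewrite -(ltr0n R).
pose tau (S : {set 'I_n}) : R := 2 * (a + eps) + gam * (ln n%:R - ln #|S|%:R).
(* As tau <= 2 and 2 (a + eps) >= 1, the logarithmic term is at most 1, so ln |S| >= ln n - 1 /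
   gam. *)
have ln_card S : dense_on G S (tau S) -> ln n%:R / 2 <= ln (#|S|%:R : R).
  move=> /(dense_on_le2 G_sym); rewrite /tau => le2.
  have : gam * (ln n%:R - ln #|S|%:R) <= gam * gam^-1.
    by rewrite divff ?gt_eqF //; lra.
  by rewrite ler_pM2l //; move: ln_n; rewrite /K; lra.
have dense_large S : dense_on G S (tau S) -> M <= #|S|%:R.
  move=> dS; have S_gt0 : (0 < #|S|)%N by case: dS.
  rewrite -ler_ln ?posrE ?ltr0n //; last by lra.
  by have := ln_card S dS; move: ln_n; rewrite /K; lra.
have q_gt0 : 0 < q_signless R G.
  by apply: lt_le_trans q_ge; rewrite !mulr_gt0 // -/a; lra.
have [x x1 xq] := q_signless_vector G_sym q_gt0.
(* On the whole vertex set the logarithmic term of [tau] vanishes, leaving exactly the spectral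
   hypothesis. *)
have dense_all : dense_on G finset.setT (tau finset.setT).
  split; first by rewrite finset.cardsT card_ord.
  exists x; rewrite x1 ltr01; split=> //.
  have -> : edge_form (induced G finset.setT) x = edge_form G x.
    by apply: eq_bigr => i _; apply: eq_bigr => j _; rewrite /induced !inE.
  rewrite xq /tau finset.cardsT card_ord subrr mulr0 addr0 mulr1 ler_pM2l //.
  by apply: le_trans q_ge; rewrite -/a; lra.
have [S dS S_deg] := dense_min_degree G_sym G_irr eps_gt0 a_ge erefl (lexx _) dense_large dense_all.
have S_gt0 : (0 < #|S|)%N by case: dS.
have S_gt0R : 0 < #|S|%:R :> R by rewrite ltr0n.
have deg_nat v : v \in S ->
    ((k * s + 2 * k) * #|S| <= #|[set y in S | G v y]| * (k * s) + s * #|S|)%N.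
  move=> vS; rewrite -(ler_nat R) -(deg_induced G vS) natrD !natrM natrD !natrM.
  have := S_deg v vS; set d := (deg _ _)%:R; set m : R := #|S|%:R => lt_d.
  have ka : k%:R * a = k%:R - 1 by rewrite /a mulrBr mulr1 divff // gt_eqF.
  have : (a + eps / 2) * m * (k%:R * s%:R) <= d * (k%:R * s%:R).
    by rewrite ler_wpM2r ?mulr_ge0 ?ler0n // ltW.
  have -> : (a + eps / 2) * m * (k%:R * s%:R) =
      (k%:R * a) * (m * s%:R) + (s%:R * eps) * (k%:R * m) / 2 by field.
  rewrite ka => le_d.
  have : 4 * (k%:R * m) <= s%:R * eps * (k%:R * m).
    by rewrite ler_wpM2r // mulr_ge0 // ltW.
  by move: le_d; lra.
have [f [f_inj _ f_edge]] := blowup_in_log G_irr G_sym (ltn0Sn _) (ltnSn k) deg_nat.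
set t := (_ %/ _)%N in f f_inj f_edge.
have t_ge := trunc_log_div_ge R S_gt0 D_gt0; rewrite -/t in t_ge.
(* The bound ln n / (2 D) - 1 is split into two equal terms: one absorbs the -1, the other is c ln
   n. *)
have t_big : ln n%:R / (4 * D%:R) + ln n%:R / (4 * D%:R) - 1 <= t%:R :> R.
  apply: (le_trans _ t_ge); rewrite lerD2r ler_pdivlMr //.
  apply: (le_trans _ (ln_card S dS)).
  suff -> : (ln n%:R / (4 * D%:R) + ln n%:R / (4 * D%:R)) * D%:R = ln n%:R / 2 :> R by [].
  by field; rewrite gt_eqF.
have ln_big : 1 <= ln n%:R / (4 * D%:R) :> R.
  rewrite ler_pdivlMr ?mulr_gt0 // mul1r; apply: (le_trans _ ln_n).
  by rewrite /K; lra.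
exists t; split; first by rewrite -(ltr0n R); lra.
split; first by rewrite mulrC; lra.
exists f; split=> // p q; exact: f_edge.
Qed.
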